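(* Let $G$ be a (Hausdorff) topological group with identity $e_G$, and let $\mathfrak{B}(G)$ be the Boolean algebra of all clopen subsets of $G$. Then $\mathfrak{B}(G)$ is not left introverted if and only if there is a clopen subset $B$ of $G$ with the following property: there are nets $(a_\gamma)_{\gamma\in\Gamma}$ in $B$ and $(c_\kappa)_{\kappa\in K}$ in $G$ such that $\lim_\kappa c_\kappa = e_G$, and for each $\kappa\in K$ there is some $\gamma_\kappa\in\Gamma$ such that $c_\kappa a_\gamma\notin B$ for all $\gamma\geq\gamma_\kappa$.
   Context: All topological spaces and groups are Hausdorff. For a topological group $G$, $\mathfrak{B}(G)$ denotes the Boolean algebra (under union, intersection, complement) of all clopen subsets of $G$. A $\mathfrak{B}(G)$-ultrafilter is an ultrafilter in this Boolean algebra. For a $\mathfrak{B}(G)$-ultrafilter $\mathcal{V}$ and $B\in\mathfrak{B}(G)$, put $\mathcal{V}\cdot B=\{s\in G: s^{-1}B\in\mathcal{V}\}$. The Boolean algebra $\mathfrak{B}(G)$ is called left introverted if $\mathcal{V}\cdot B\in\mathfrak{B}(G)$ (i.e. $\mathcal{V}\cdot B$ is clopen in $G$) for every $\mathfrak{B}(G)$-ultrafilter $\mathcal{V}$ and every $B\in\mathfrak{B}(G)$. *)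

(* Defs.v *)
From HB Require Import structures.
From mathcomp Require Import all_boot.
From mathcomp Require Import boolp classical_sets filter topology.
Set Implicit Arguments.
Unset Strict Implicit.
Unset Printing Implicit Defensive.
Local Open Scope classical_set_scope.
Local Open Scope group_scope.

HB.mixin Record PreTopologicalGroup_isTopologicalGroup G
    of Topological G & Group G := {
  mulg_continuous : continuous (fun x : G * G => x.1 * x.2) ;
  invg_continuous : continuous (fun x : G => x^-1)
}.

#[short(type="topologicalGroupType")]
HB.structure Definition TopologicalGroup :=
  {G of PreTopologicalGroup_isTopologicalGroup G & Topological G & Group G}.

(* Directed sets are preorders: antisymmetry is not required. *)
Record directedType := DirectedType {
  directed_sort :> Type ;
  directed_le : directed_sort -> directed_sort -> Prop ;
  directed_inhabited : inhabited directed_sort ;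
  directed_refl : forall i, directed_le i i ;
  directed_trans : forall i j k,
    directed_le i j -> directed_le j k -> directed_le i k ;
  directed_upper : forall i j, exists k, directed_le i k /\ directed_le j k
}.

(* A net u : I -> T converges to x when u @ tails I --> x. *)
Definition tails (I : directedType) : set_system I :=
  filter_from [set: I] (fun i => [set j | directed_le i j]).

Arguments tails : clear implicits.

Section SubalgebraUltrafilters.
Variables (T : Type) (A : set_system T).

Record algebra_proper_filter (F : set_system T) : Prop := {
  algebra_filter_sub : F `<=` A ;
  algebra_filterT : F [set: T] ;
  algebra_filterI : forall P Q, F P -> F Q -> F (P `&` Q) ;
  algebra_filterS : forall P Q, A Q -> P `<=` Q -> F P -> F Q ;
  algebra_filter_not_empty : ~ F set0
}.

Record algebra_ultrafilter (V : set_system T) : Prop := {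
  algebra_ultra_proper : algebra_proper_filter V ;
  algebra_ultra_max :
    forall F, algebra_proper_filter F -> V `<=` F -> F = V
}.

End SubalgebraUltrafilters.

Definition clopen_algebra (G : topologicalType) : set_system G :=
  [set B | clopen B].

Arguments clopen_algebra : clear implicits.

Definition ultra_mul (G : groupType) (V : set_system G) (B : set G) : set G :=
  [set s | V [set s^-1 * b | b in B]].

Definition left_introverted (G : groupType) (A : set_system G) : Prop :=
  forall (V : set_system G) (B : set G),
    algebra_ultrafilter A V -> A B -> A (ultra_mul V B).

(* Main.v *)
(** A subset of [G] fails to be clopen exactly when it or its complement fails
    to be open, and [V . (~` B) = ~` (V . B)]; so, up to exchanging [B] and
    [~` B] and translating, non-introversion means that [B] lies in [V] while
    every neighbourhood of [1] contains some [c] with [c^-1 B] outside [V].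
    Choosing points along [V] and along the neighbourhoods of [1] yields the
    nets.  Conversely, the trace on the clopen sets of any ultrafilter refining
    the net [a] puts [1] in [V . B] but no [c k], so [V . B] is not open. *)
Require Import Defs.
From HB Require Import structures.
From mathcomp Require Import all_boot.
From mathcomp Require Import boolp classical_sets filter topology.
Set Implicit Arguments.
Unset Strict Implicit.
Unset Printing Implicit Defensive.
Local Open Scope classical_set_scope.
Local Open Scope group_scope.

Lemma tails_proper (I : directedType) : ProperFilter (tails I).
Proof.
apply: filter_from_proper.
  apply: filter_from_filter.
    by have [i] := directed_inhabited I; exists i.
  move=> i j _ _; have [k [ik jk]] := directed_upper i j; exists k => // l kl.
  by split; [exact: directed_trans ik kl|exact: directed_trans jk kl].
by move=> i _; exists i; exact: directed_refl.
Qed.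

Section Algebras.
Variables (T : Type) (A : set_system T).
Hypotheses (AT : A [set: T]) (AC : forall P, A P -> A (~` P)).
Hypothesis AI : forall P Q, A P -> A Q -> A (P `&` Q).

Lemma algebra_ultra_em (V : set_system T) (P : set T) :
  algebra_ultrafilter A V -> A P -> V P \/ V (~` P).
Proof.
move=> [[VA VT VI VS V0] Vmax] AP; have [VnP|nVnP] := pselect (V (~` P)).
  by right.
left; pose F := [set Q | A Q /\ exists2 D, V D & D `&` P `<=` Q].
suff FV : F = V by rewrite -FV; split=> //; exists [set: T] => // x [].
apply: Vmax; last by move=> D VD; split; [exact: VA|exists D => // x []].
split.
- by move=> Q [].
- by split=> //; exists [set: T].
- move=> Q R [AQ [D VD DQ]] [AR [E VE ER]]; split; first exact: AI.
  exists (D `&` E); first exact: VI.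
  by move=> x [[Dx Ex] Px]; split; [exact: DQ|exact: ER].
- move=> Q R AR QR [AQ [D VD DQ]]; split=> //.
  by exists D => //; exact: subset_trans QR.
- move=> [_ [D VD DP]]; apply: nVnP; apply: (VS D) => //; first exact: AC.
  by move=> x Dx Px; apply: (DP x).
Qed.

Lemma algebra_ultraC (V : set_system T) (P : set T) :
  algebra_ultrafilter A V -> A P -> V (~` P) <-> ~ V P.
Proof.
move=> Vu AP; have [[VA VT VI VS V0] _] := Vu; split.
  by move=> VnP VP; apply: V0; rewrite -(setICr P); exact: VI.
by case: (algebra_ultra_em Vu AP).
Qed.

(** Maximality comes from complements: a set of [A] outside [U] has its complement in the trace, so
    no proper filter of [A] above the trace can contain it. *)
Lemma algebra_ultrafilter_trace (U : set_system T) :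
  UltraFilter U -> algebra_ultrafilter A (U `&` A).
Proof.
move=> UU; split.
  split.
  - by move=> P [].
  - by split=> //; exact: filterT.
  - by move=> P Q [UP AP] [UQ AQ]; split; [exact: filterI|exact: AI].
  - by move=> P Q AQ PQ [UP _]; split=> //; exact: filterS UP.
  - by move=> [/filter_not_empty].
move=> F [FA FT FI FS F0] UF; apply/seteqP; split=> // P FP.
have AP := FA _ FP; split=> //.
have [//|UnP] := in_ultra_setVsetC P UU.
exfalso; apply: F0; rewrite -(setICr P); apply: FI => //.
by apply: UF; split=> //; exact: AC.
Qed.

End Algebras.

Section TopologicalGroups.
Variable G : topologicalGroupType.
Implicit Types (V : set_system G) (B : set G) (s : G).

Lemma lmulg_continuous s : continuous (fun x : G => s * x).
Proof.
move=> x; apply: (cvg_comp2 (cvg_cst s) (@cvg_id _ (nbhs x))).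
exact: (@mulg_continuous G (s, x)).
Qed.

Lemma image_lmulVg s B :
  [set s^-1 * b | b in B] = (fun x => s * x) @^-1` B.
Proof.
apply/seteqP; split=> [_ [b Bb <-]|x /= Bx]; first by rewrite /= mulVKg.
by exists (s * x) => //; rewrite mulKg.
Qed.

Lemma clopen_preimage_lmulg s B :
  clopen B -> clopen ((fun x => s * x) @^-1` B).
Proof. by move=> cB; apply: preimage_clopen => //; exact: lmulg_continuous. Qed.

Lemma clopen_ultraC V B : algebra_ultrafilter (clopen_algebra G) V ->
  clopen B -> V (~` B) <-> ~ V B.
Proof.
apply: algebra_ultraC; [exact: clopenT| |exact: clopenI].
by move=> P; exact: (clopenC P).
Qed.

Lemma ultra_mulC V B : algebra_ultrafilter (clopen_algebra G) V ->
  clopen B -> ultra_mul V (~` B) = ~` ultra_mul V B.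
Proof.
move=> Vu cB; apply/seteqP; split=> s; rewrite /ultra_mul /= !image_lmulVg;
  by rewrite preimage_setC clopen_ultraC //; exact: clopen_preimage_lmulg.
Qed.

Lemma not_left_introverted_witness :
  ~ left_introverted (clopen_algebra G) ->
  exists V B, [/\ algebra_ultrafilter (clopen_algebra G) V, clopen B, V B &
    forall U : set G, nbhs 1 U ->
      exists2 c, U c & V (~` ((fun x => c * x) @^-1` B))].
Proof.
move=> /existsNP[V /existsNP[B /not_implyP[Vu /not_implyP[cB nc]]]].
(* If every [ultra_mul V B] with [B] clopen were open, [ultra_mulC] would make each of them closed
   too. *)
have {B cB nc} [B cB no] : exists2 B, clopen B & ~ open (ultra_mul V B).
  apply: contrapT => H; apply: nc; split.
    by apply: contrapT => no; apply: H; exists B.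
  rewrite -openC -ultra_mulC//; apply: contrapT => no; apply: H.
  by exists (~` B) => //; exact: (clopenC B).
move: no; rewrite openE => /existsNP[s /not_implyP[Vs ns]].
(* Here [s] is a non-interior point of [ultra_mul V B]; passing to the translate [s^-1 B] moves it
   to [1]. *)
exists V, ((fun x => s * x) @^-1` B); split => //.
- exact: clopen_preimage_lmulg.
- by move: Vs; rewrite /ultra_mul /= image_lmulVg.
move=> U U1; apply: contrapT => H; apply: ns.
(* This set is [s U]; without a suitable [c] in [U] it would lie inside [ultra_mul V B]. *)
have : nbhs s ((fun x => s^-1 * x) @^-1` U).
  by apply: lmulg_continuous; rewrite mulVg.
apply: filterS => x /= Ux; apply: contrapT => nx; apply: H.
exists (s^-1 * x) => //; rewrite clopen_ultraC//; last first.
  by do 2 apply: clopen_preimage_lmulg.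
move: nx; rewrite /ultra_mul /= image_lmulVg; apply: contra_not.
by congr V; apply/funext => y /=; rewrite mulgA mulVKg.
Qed.

End TopologicalGroups.

Section ReverseInclusion.
Variables (T : Type) (F : set_system T).
Hypotheses (FT : F [set: T]) (FI : forall P Q, F P -> F Q -> F (P `&` Q)).

(** Indexes both nets: [F] is the ultrafilter [V] for [a], and the neighbourhood filter of [1] for
    [c]. *)
Definition reverse_inclusion : directedType.
Proof.
refine (@DirectedType {P | F P} (fun P Q => sval Q `<=` sval P) _ _ _ _).
- by constructor; exists [set: T].
- by move=> P.
- by move=> P Q R PQ QR; exact: subset_trans PQ.
- move=> [P FP] [Q FQ]; exists (exist _ _ (FI FP FQ)).
  by split=> x [].
Defined.

End ReverseInclusion.

Theorem theorem2p2 (G : topologicalGroupType) (hG : hausdorff_space G) :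
  ~ left_introverted (clopen_algebra G) <->
  exists B : set G, clopen B /\
    exists (Gam K : directedType) (a : Gam -> G) (c : K -> G),
      [/\ forall g : Gam, B (a g),
          c @ tails K --> (1 : G)
        & forall k : K, exists gk : Gam,
            forall g : Gam, directed_le gk g -> ~ B (c k * a g)].
Proof.
split.
- move=> /not_left_introverted_witness[V [B [Vu cB VB small]]].
  have [[VA VT VI VS V0] _] := Vu; exists B; split=> //.
  have a_ex (D : {D | V D}) : exists x, sval D x /\ B x.
    case: D => D VD /=; apply: contrapT => H; apply: V0.
    rewrite (_ : set0 = D `&` B); first exact: VI.
    by apply/esym/seteqP; split=> // x DBx; apply: H; exists x.
  have c_ex (U : {U : set G | nbhs 1 U}) :
      exists c, sval U c /\ V (~` ((fun x => c * x) @^-1` B)).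
    by have [c Uc Vc] := small _ (svalP U); exists c.
  have [a aP] := choice a_ex; have [c cP] := choice c_ex.
  exists (reverse_inclusion VT VI).
  exists (reverse_inclusion (@filterT _ (nbhs (1 : G)) _)
                            (@filterI _ (nbhs (1 : G)) _)).
  exists a, c; split.
  + by move=> g; have [] := aP g.
  + move=> U U1; exists (exist _ U U1) => // W /= WU.
    by apply: WU; have [] := cP W.
  (* The threshold index is the complement of [(c k)^-1 B] itself, a member of [V]: any smaller [g]
     has [a g] inside it. *)
  + move=> k; have [_ Vk] := cP k; exists (exist _ _ Vk) => g /= gk.
    by apply: gk; have [] := aP g.
- move=> [B [cB [Gam [K [a [c [aB c1 ac]]]]]]] intro.
  have /ultraFilterLemma[U [UU aU]] : ProperFilter (a @ tails Gam).
    by have := tails_proper Gam; exact: fmap_proper_filter.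
  pose V := U `&` clopen_algebra G.
  have Vu : algebra_ultrafilter (clopen_algebra G) V.
    apply: algebra_ultrafilter_trace => // [|P|]; first exact: clopenT.
      exact: (clopenC P).
    exact: clopenI.
  have [oVB _] := intro V B Vu cB.
  have VB1 : ultra_mul V B 1.
    rewrite /ultra_mul /= image_lmulVg; split; last first.
      exact: clopen_preimage_lmulg.
    (* Any starting index will do, since the whole net [a] stays in [B]. *)
    apply: aU; have [g] := directed_inhabited Gam; exists g => // h _ /=.
    by rewrite mul1g.
  (* Openness of [ultra_mul V B] around [1] forces some [c k] into it, whereas a tail of [a] puts
     the complement of [(c k)^-1 B] in [U]. *)
  have [k _ kVB] := c1 _ (open_nbhs_nbhs (conj oVB VB1)).
  have := kVB k (directed_refl k).
  rewrite /ultra_mul /= image_lmulVg => -[Uk _].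
  have [gk gkP] := ac k.
  have Unk : U (~` ((fun x => c k * x) @^-1` B)) by apply: aU; exists gk.
  by apply: (@filter_not_empty _ U _); have := filterI Uk Unk; rewrite setICr; apply.
Qed.
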